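(* Let $C$ be any CAT(0) cube complex (of arbitrary, possibly infinite, dimension). Then $C$ is cubical.
   Context: A cube complex is a quotient of a disjoint union of Euclidean cubes of side length 1 obtained by gluing faces by isometries, such that the interior of every face of every cube injects into $C$; more precisely, with $p$ the quotient map, $p$ is injective on the interior of each face of each cube, and whenever $p(x_1)=p(x_2)$ there is an isometry $h$ from the smallest closed face containing $x_1$ onto the smallest closed face containing $x_2$ with $p(y)=p(h(y))$ for all $y$. Closed cubes need not embed and two cubes may meet in more than one face. A cube complex is cubical (a cubical complex) if each closed cube embeds and the intersection of any two closed cubes is empty or a single common face of both. The metric on a connected cube complex is the path metric: the infimum of lengths of piecewise linear paths. CAT(0) means geodesic with every geodesic triangle at least as thin as its Euclidean comparison triangle. *)

(* Defs.v *)
From HB Require Import structures.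
From mathcomp Require Import all_boot all_order all_algebra.
From mathcomp Require Import all_classical all_reals.

Set Implicit Arguments.
Unset Strict Implicit.
Unset Printing Implicit Defensive.

Import Order.TTheory GRing.Theory Num.Theory.

Local Open Scope classical_set_scope.
Local Open Scope ring_scope.

(* The library norm on row vectors is the sup norm, hence this l2 distance. *)
Definition edist (R : realType) (n : nat) (x y : 'rV[R]_n) : R :=
  Num.sqrt (\sum_(j < n) (x 0 j - y 0 j) ^+ 2).

Definition cube (R : realType) (n : nat) : Type :=
  {x : 'rV[R]_n | [forall j, 0 <= x 0 j <= 1]}.

Definition cube_coord (R : realType) (n : nat) (x : cube R n) (j : 'I_n) : R :=
  val x 0 j.

Definition cdist (R : realType) (n : nat) (x y : cube R n) : R :=
  edist (val x) (val y).

(* A closed nonempty face of [0,1]^n is coded by [f : 'I_n -> option bool]: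
   [Some b] fixes a coordinate to the endpoint [b], [None] leaves it free.
   The cube itself is the face coded by [fun=> None]. *)
Definition face (R : realType) (n : nat) (f : 'I_n -> option bool) :
    set (cube R n) :=
  [set x | forall j b, f j = Some b -> cube_coord x j = (nat_of_bool b)%:R].

(* Interior relative to the affine span of the face, so that the interior of a
   vertex is that vertex. *)
Definition face_interior (R : realType) (n : nat) (f : 'I_n -> option bool) :
    set (cube R n) :=
  [set x | face f x /\ forall j, f j = None -> 0 < cube_coord x j < 1].

(* Two faces containing [x] meet in a face, so the intersection of all of them
   is the smallest closed face containing [x]. *)
Definition smallest_face (R : realType) (n : nat) (x : cube R n) :
    set (cube R n) :=
  [set y | forall f, face f x -> face f y].

(* The quotient of the disjoint union of the cubes is given by its underlying
   set [carrier] and the restrictions [cell_map i] of the quotient map to each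
   cube. *)
Record cube_complex (R : realType) := CubeComplex {
  carrier : Type;
  cell : Type;
  cell_dim : cell -> nat;
  cell_map : forall i : cell, cube R (cell_dim i) -> carrier;
  cell_map_surj : forall c : carrier,
    exists i (x : cube R (cell_dim i)), cell_map x = c;
  cell_map_inj : forall (i : cell) (f : 'I_(cell_dim i) -> option bool)
      (x y : cube R (cell_dim i)),
    face_interior f x -> face_interior f y -> cell_map x = cell_map y -> x = y;
  cell_map_isometry : forall (i1 i2 : cell)
      (x1 : cube R (cell_dim i1)) (x2 : cube R (cell_dim i2)),
    cell_map x1 = cell_map x2 ->
    exists h : cube R (cell_dim i1) -> cube R (cell_dim i2),
      [/\ {in smallest_face x1 &, forall y z, cdist (h y) (h z) = cdist y z},
          h @` smallest_face x1 = smallest_face x2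
        & {in smallest_face x1, forall y, cell_map y = cell_map (h y)}]
}.

Section PathMetric.
Variables (R : realType) (C : cube_complex R).

(* The straight segment of [C] that is the image of the segment from [seg_src]
   to [seg_dst] in the cube [seg_cell]. The cube and the lifts of the endpoints
   are recorded because closed cubes need not embed in [C]. *)
Record segment := Segment {
  seg_cell : cell C;
  seg_src : cube R (cell_dim seg_cell);
  seg_dst : cube R (cell_dim seg_cell)
}.

(* A piecewise linear path, up to reparametrisation, is a finite concatenation
   of such segments. *)
Fixpoint pl_path (x : carrier C) (s : seq segment) (y : carrier C) : Prop :=
  if s is e :: s' then
    cell_map (seg_src e) = x /\ pl_path (cell_map (seg_dst e)) s' y
  else x = y.

Definition pl_length (s : seq segment) : R :=
  \sum_(e <- s) cdist (seg_src e) (seg_dst e).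

Definition pl_connected : Prop := forall x y, exists s, pl_path x s y.

(* [inf] is the true infimum only on nonempty sets, that is, when [x] and [y]
   are joined by a path. *)
Definition path_dist (x y : carrier C) : R :=
  inf [set l | exists2 s, pl_path x s y & l = pl_length s].

End PathMetric.

Section CAT0.
Variables (R : realType) (X : Type) (d : X -> X -> R).

Definition is_metric : Prop :=
  [/\ forall x y, d x y = 0 <-> x = y,
      forall x y, d x y = d y x
    & forall x y z, d x z <= d x y + d y z].

Definition geodesic (x y : X) (g : R -> X) : Prop :=
  [/\ g 0 = x, g (d x y) = y
    & forall s t, 0 <= s <= d x y -> 0 <= t <= d x y ->
        d (g s) (g t) = `|s - t|].

Definition geodesic_space : Prop := forall x y, exists g, geodesic x y g.

Definition geodesic_segment (x y : X) (S : set X) : Prop :=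
  exists2 g, geodesic x y g & S = [set g t | t in [set t | 0 <= t <= d x y]].

(* [w'] is the comparison point, on the Euclidean segment from [x'] to [y'], of
   the point [w] of the geodesic segment [S] issuing from [x]. *)
Definition comparison_point (S : set X) (x : X) (x' y' : 'rV[R]_2)
    (w : X) (w' : 'rV[R]_2) : Prop :=
  [/\ S w,
      exists2 t : R, 0 <= t <= 1 & w' = (1 - t) *: x' + t *: y'
    & edist x' w' = d x w].

Definition thin_triangles : Prop :=
  forall (x y z : X) (Sxy Syz Szx : set X),
    geodesic_segment x y Sxy ->
    geodesic_segment y z Syz ->
    geodesic_segment z x Szx ->
  forall x' y' z' : 'rV[R]_2,
    edist x' y' = d x y -> edist y' z' = d y z -> edist z' x' = d z x ->
  let comparison w w' :=
    [\/ comparison_point Sxy x x' y' w w',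
        comparison_point Syz y y' z' w w'
      | comparison_point Szx z z' x' w w'] in
  forall u u' v v', comparison u u' -> comparison v v' ->
    d u v <= edist u' v'.

Definition CAT0 : Prop := [/\ is_metric, geodesic_space & thin_triangles].

End CAT0.

Definition closed_cube (R : realType) (C : cube_complex R) (i : cell C) :
    set (carrier C) :=
  [set cell_map x | x in [set: cube R (cell_dim i)]].

Definition cubical (R : realType) (C : cube_complex R) : Prop :=
  (forall i : cell C, injective (@cell_map R C i)) /\
  (forall i j : cell C,
     closed_cube i `&` closed_cube j = set0 \/
     exists (f : 'I_(cell_dim i) -> option bool)
            (g : 'I_(cell_dim j) -> option bool),
       closed_cube i `&` closed_cube j = [set cell_map x | x in face f] /\
       closed_cube i `&` closed_cube j = [set cell_map x | x in face g]).

(* Main.v *)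
Require Import Defs.
From HB Require Import structures.
From mathcomp Require Import all_boot all_order all_algebra.
From mathcomp Require Import all_classical all_reals.
From mathcomp Require Import ring lra.

(** The theorem follows from one fact: every closed cube, with its Euclidean
    metric, embeds isometrically in [C] ([cube_isometry]). Cell maps are then
    injective. Moreover the Euclidean midpoint of two points of a cube is a
    midpoint for the path metric, and midpoints are unique in a CAT(0) space;
    so if two closed cubes share two points they share the midpoint of these
    ([closed_cube_midpoint]). The points of one cube that lie in another thus
    form a set closed under midpoints, which contains the smallest face of each
    of its points because the gluing maps are defined on whole faces. Such a
    set is a single face ([midpoint_closed_face]).

    The isometric embedding is proved first near a point and then globally.

    Near a point ([local_isometry]): call [e] a clearance of [x] if [x] stays
    at distance at least [e] from every face of its cube that does not contain
    it. A path in [C] that starts at the image of [x] can be followed by a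
    Euclidean segment that ends at a lift of this image: as long as the segment
    is shorter than [e], the lift lies in the smallest face of the moving
    point, so the gluing isometries carry the whole segment from cube to cube
    ([path_lift]). Its length is at most that of the path. For this the
    clearance must be the same for all lifts of a point, although the gluing
    maps are only known to be isometries of faces. The reason is that clearance
    has a purely metric description: all segments that arrive at [x] within its
    smallest face can be extended by [e] ([extendable]).

    Globally: on a segment in the open cube the clearance is bounded below, so
    the segment is a local geodesic, and in a CAT(0) space local geodesics are
    geodesics ([CAT0_geodesic_extend]). Closed cubes follow by continuity. All
    uses of thin triangles go through the inequality of Bruhat and Tits in the
    form [CAT0_CN].

    The cubes of [C] may have unbounded dimension: nothing above compares the
    clearances of different points of [C]. *)

Set Implicit Arguments.
Unset Strict Implicit.
Unset Printing Implicit Defensive.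

Import Order.TTheory GRing.Theory Num.Theory.

Local Open Scope classical_set_scope.
Local Open Scope ring_scope.

(** * Euclidean distance *)

Lemma conv_itv (R : realType) (a b u v t : R) :
  0 <= t <= 1 -> a <= u <= b -> a <= v <= b -> a <= (1 - t) * u + t * v <= b.
Proof.
move=> /andP[t0 t1] /andP[au ub] /andP[av vb].
have s0 : 0 <= 1 - t by rewrite subr_ge0.
have := mulr_ge0 s0 (_ : 0 <= u - a); have := mulr_ge0 t0 (_ : 0 <= v - a).
have := mulr_ge0 s0 (_ : 0 <= b - u); have := mulr_ge0 t0 (_ : 0 <= b - v).
rewrite !subr_ge0 => /(_ vb) H1 /(_ ub) H2 /(_ av) H3 /(_ au) H4.
by apply/andP; split; lra.
Qed.

Section Euclid.
Variables (R : realType) (n : nat).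
Implicit Types (x y z w m : 'rV[R]_n) (t : R).

Lemma edist_ge0 x y : 0 <= edist x y.
Proof. exact: sqrtr_ge0. Qed.

Lemma edist_sqr x y : edist x y ^+ 2 = \sum_(j < n) (x 0 j - y 0 j) ^+ 2.
Proof. by rewrite sqr_sqrtr // sumr_ge0 // => j _; exact: sqr_ge0. Qed.

Lemma edistC x y : edist x y = edist y x.
Proof.
by rewrite /edist; congr Num.sqrt; apply: eq_bigr => j _; ring.
Qed.

Lemma edist_coord x y j : `|x 0 j - y 0 j| <= edist x y.
Proof.
rewrite -sqrtr_sqr ler_sqrt; last by apply: sumr_ge0 => k _; exact: sqr_ge0.
by rewrite (bigD1 j) //= lerDl sumr_ge0 // => k _; exact: sqr_ge0.
Qed.

Lemma edist_eq0 x y : edist x y = 0 -> x = y.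
Proof.
move=> d0; apply/rowP => j; apply/eqP; rewrite -subr_eq0 -normr_le0 -d0.
exact: edist_coord.
Qed.

Lemma edistxx x : edist x x = 0.
Proof.
by apply/eqP; rewrite -sqrf_eq0 edist_sqr big1 // => j _; rewrite subrr expr0n.
Qed.

Lemma edist_scale (c : R) x y z w :
  (forall j, x 0 j - y 0 j = c * (z 0 j - w 0 j)) ->
  edist x y = `|c| * edist z w.
Proof.
move=> E; rewrite -sqrtr_sqr -sqrtrM ?sqr_ge0 // mulr_sumr; congr Num.sqrt.
by apply: eq_bigr => j _; rewrite E exprMn.
Qed.

(** The Cauchy-Schwarz inequality for the sums of squares, from the expansion
    of the sum of the squares of [A * v - B * u]. *)
Lemma sum_CauchySchwarz (u v : 'I_n -> R) :
  (\sum_j u j * v j) ^+ 2 <= (\sum_j u j ^+ 2) * (\sum_j v j ^+ 2).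
Proof.
set A := \sum_j u j ^+ 2; set B := \sum_j _; set C := \sum_j v j ^+ 2.
have A0 : 0 <= A by apply: sumr_ge0 => j _; exact: sqr_ge0.
have : 0 <= \sum_j (A * v j - B * u j) ^+ 2.
  by apply: sumr_ge0 => j _; exact: sqr_ge0.
have -> : \sum_j (A * v j - B * u j) ^+ 2 = A * (A * C - B ^+ 2).
  transitivity (\sum_j (A ^+ 2 * v j ^+ 2 + (- 2 * A * B) * (u j * v j)
                        + B ^+ 2 * u j ^+ 2)).
    by apply: eq_bigr => j _; ring.
  by rewrite !big_split /= -!mulr_sumr -/A -/B -/C; ring.
case: (eqVneq A 0) => [A00 _|An0]; last first.
  by rewrite pmulr_rge0 ?lt_neqAle ?A0 1?eq_sym ?An0 // subr_ge0.
have B0 : B = 0.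
  rewrite /B big1 // => j _; suff -> : u j = 0 by rewrite mul0r.
  move/eqP: A00; rewrite psumr_eq0; last by move=> k _; exact: sqr_ge0.
  by move=> /allP /(_ j (mem_index_enum j)); rewrite /= sqrf_eq0 => /eqP.
by rewrite B0 A00 mul0r expr0n.
Qed.

Lemma edist_triangle x y z : edist x z <= edist x y + edist y z.
Proof.
rewrite -ler_sqr ?nnegrE ?addr_ge0 ?edist_ge0 //.
have a0 := edist_ge0 x y; have b0 := edist_ge0 y z.
set u := fun j => x 0 j - y 0 j; set v := fun j => y 0 j - z 0 j.
have CS := sum_CauchySchwarz u v.
have : \sum_j u j * v j <= edist x y * edist y z.
  apply: le_trans (ler_norm _) _.
  by rewrite -ler_sqr ?nnegrE ?mulr_ge0 // real_normK ?num_real // exprMn !edist_sqr.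
have -> : edist x z ^+ 2 =
    edist x y ^+ 2 + 2 * (\sum_j u j * v j) + edist y z ^+ 2.
  rewrite !edist_sqr mulr_sumr -!big_split /=.
  by apply: eq_bigr => j _; rewrite /u /v; ring.
by move=> ?; lra.
Qed.

(** Stewart's identity. *)
Lemma edist_stewart x y z t :
  edist z ((1 - t) *: x + t *: y) ^+ 2 =
  (1 - t) * edist z x ^+ 2 + t * edist z y ^+ 2 - t * (1 - t) * edist x y ^+ 2.
Proof.
rewrite !edist_sqr !mulr_sumr -sumrN -!big_split /=.
by apply: eq_bigr => j _; rewrite !mxE; ring.
Qed.

Lemma edist_conv x y s t :
  edist ((1 - s) *: x + s *: y) ((1 - t) *: x + t *: y) =
  `|s - t| * edist x y.
Proof. by rewrite (edist_scale (c := t - s) (z := x) (w := y)) 1?distrC // => j; rewrite !mxE; ring. Qed.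

(** The Euclidean metric is strictly convex: by Stewart's identity the point of
    the segment that divides it in the same ratio is at distance [0]. *)
Lemma edist_between x m y :
  0 < edist x y -> edist x y = edist x m + edist m y ->
  m = (1 - edist x m / edist x y) *: x + (edist x m / edist x y) *: y.
Proof.
move=> D0 E; apply: edist_eq0; apply/eqP; rewrite -sqrf_eq0 edist_stewart.
rewrite (edistC m x); apply/eqP.
have -> : edist m y = edist x y - edist x m by rewrite E; ring.
by field; rewrite gt_eqF.
Qed.

End Euclid.

(** * Faces of a Euclidean cube *)

Section CubeGeometry.
Variables (R : realType) (n : nat).
Implicit Types (x y z w a : cube R n) (e t : R).

Lemma coord_itv x j : 0 <= val x 0 j <= 1.
Proof. by case: x => v /= /forallP /(_ j). Qed.

Lemma cube_lift (v : 'rV[R]_n) :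
  (forall j, 0 <= v 0 j <= 1) -> exists x : cube R n, val x = v.
Proof. by move=> /forallP H; exists (exist _ v H). Qed.

Lemma cube_conv x y t : 0 <= t <= 1 ->
  exists m : cube R n, val m = (1 - t) *: val x + t *: val y.
Proof.
move=> t01; apply: cube_lift => j; rewrite !mxE.
by apply: conv_itv => //; exact: coord_itv.
Qed.

Lemma cdist_gt0 x y : x <> y -> 0 < cdist x y.
Proof.
move=> xy; rewrite lt_neqAle edist_ge0 andbT eq_sym; apply/eqP.
by move=> /edist_eq0 /val_inj.
Qed.

Lemma smallest_faceP x y :
  smallest_face x y <->
  forall j (b : bool), val x 0 j = b%:R -> val y 0 j = b%:R.
Proof.
split=> [H j b xj|H f fx j b fj]; last by apply: H; exact: fx.
apply: (H (fun k => if k == j then Some b else None)); last by rewrite eqxx.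
by move=> k c; case: eqP => // -> [<-].
Qed.

Lemma smallest_face_refl x : smallest_face x x.
Proof. by move=> f. Qed.

(** The code of the smallest face containing [x]. *)
Definition face_code x : 'I_n -> option bool := fun j =>
  if val x 0 j == 0 then Some false
  else if val x 0 j == 1 then Some true else None.

Lemma face_codeE x : face (face_code x) = smallest_face x.
Proof.
apply/seteqP; split=> y.
  move=> fy; apply/smallest_faceP => j b xj; apply: fy; rewrite /face_code xj.
  by case: b {xj}; rewrite ?oner_eq0 eqxx.
move=> xy; apply: (xy) => j b; rewrite /face_code /cube_coord.
by case: eqP => [->|_]; [|case: eqP => [->|_]] => // -[<-].
Qed.

Lemma face_code_interior x y :
  smallest_face x y -> smallest_face y x -> face_interior (face_code x) y.
Proof.
move=> xy yx; split; first by rewrite face_codeE.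
move=> j; rewrite /face_code /cube_coord.
have /smallest_faceP yxj := yx.
case: eqP => // x0; case: eqP => // x1 _.
have /andP[y0 y1] := coord_itv y j.
rewrite !lt_neqAle y0 y1 !andbT; apply/andP; split; apply/eqP => E.
  by apply: x0; apply: (yxj j false).
by apply: x1; apply: (yxj j true).
Qed.

(** For [e <= 1] this says that [x] is at distance at least [e] from each face
    that does not contain it; a coordinate [0] or [1] is at distance [1] from
    the opposite facet. *)
Definition clearance e x : Prop :=
  [/\ 0 < e, e <= 1 & forall j,
      val x 0 j <> 0 -> val x 0 j <> 1 -> e <= val x 0 j <= 1 - e].

(** Clearance in terms of distances inside the smallest face of [x] alone, so
    that isometries between smallest faces preserve it; see
    [clearance_extendable] and [extendable_clearance]. *)
Definition extendable e x : Prop :=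
  [/\ 0 < e, e <= 1 & forall z, smallest_face x z -> z <> x ->
      exists w, [/\ smallest_face x w, cdist x w = e
                  & cdist z w = cdist z x + e]].

Lemma clearance_exists x : exists e, clearance e x.
Proof.
pose c j : R := if (val x 0 j == 0) || (val x 0 j == 1) then 1
                else Num.min (val x 0 j) (1 - val x 0 j).
exists (\big[Order.min/1]_j c j); split; last 2 first.
- exact: bigmin_le_id.
- move=> j /eqP x0 /eqP x1.
  have : \big[Order.min/1]_j c j <= c j by exact: bigmin_le_cond.
  rewrite /c (negPf x0) (negPf x1) /= le_min => /andP[] ? ?.
  by apply/andP; split; lra.
apply: lt_bigmin => // j _; rewrite /c.
case: ifPn => //; rewrite negb_or => /andP[x0 x1].
have /andP[p0 p1] := coord_itv x j.
by rewrite lt_min subr_gt0 !lt_neqAle p0 p1 x1 eq_sym x0.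
Qed.

Lemma clearance_smallest_face e x a :
  clearance e x -> cdist x a < e -> smallest_face a x.
Proof.
move=> [e0 e1 He] xa; apply/smallest_faceP => j b aj.
have := le_lt_trans (edist_coord (val x) (val a) j) xa; rewrite aj ltr_norml.
case: (eqVneq (val x 0 j) 0) => [->|/eqP x0].
  by case: b {aj} => // /andP[] /= ? ?; lra.
case: (eqVneq (val x 0 j) 1) => [->|/eqP x1].
  by case: b {aj} => // /andP[] /= ? ?; lra.
have /andP[? ?] := He j x0 x1.
by case: b {aj} => /andP[] /= ? ?; lra.
Qed.

Lemma clearance_extendable e x : clearance e x -> extendable e x.
Proof.
move=> [e0 e1 He]; split=> // z /smallest_faceP xz zx.
have D0 := cdist_gt0 zx; set D := cdist z x in D0 *.
pose v := (1 - (1 + e / D)) *: val z + (1 + e / D) *: val x.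
have vE j : v 0 j = val x 0 j + e / D * (val x 0 j - val z 0 j).
  by rewrite !mxE; ring.
(* No coordinate of [w] differs from that of [x] by more than the clearance. *)
have shift j : `|e / D * (val x 0 j - val z 0 j)| <= e.
  rewrite normrM ger0_norm ?divr_ge0 ?(ltW D0) ?(ltW e0) //.
  rewrite mulrAC ler_pdivrMr // ler_pM2l // distrC; exact: edist_coord.
have vx j (b : bool) : val x 0 j = b%:R -> v 0 j = b%:R.
  by move=> xj; rewrite vE xj (xz _ _ xj) subrr mulr0 addr0.
have [w Ew] : exists w : cube R n, val w = v.
  apply: cube_lift => j.
  case: (eqVneq (val x 0 j) 0) => [x0|/eqP x0].
    by rewrite (vx j false x0) lexx ler01.
  case: (eqVneq (val x 0 j) 1) => [x1|/eqP x1].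
    by rewrite (vx j true x1) lexx ler01.
  have /andP[? ?] := He j x0 x1.
  have := shift j; rewrite vE ler_norml => /andP[? ?].
  by apply/andP; split; lra.
have eD : e / D * D = e by rewrite divfK // gt_eqF.
exists w; split; first by apply/smallest_faceP => j b; rewrite Ew; exact: vx.
- rewrite /cdist Ew (edist_scale (c := e / D) (z := val z) (w := val x)); last first.
    by move=> j; rewrite vE; ring.
  by rewrite ger0_norm ?divr_ge0 ?(ltW D0) ?(ltW e0).
- rewrite /cdist Ew (edist_scale (c := 1 + e / D) (z := val z) (w := val x)); last first.
    by move=> j; rewrite vE; ring.
  rewrite ger0_norm ?addr_ge0 ?divr_ge0 ?(ltW D0) ?(ltW e0) //.
  by rewrite mulrDl mul1r eD.
Qed.

(** Extending the segment that comes perpendicularly from a facet by [e]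
    shows that the opposite facet is at distance at least [e]. *)
Lemma extendable_clearance e x : extendable e x -> clearance e x.
Proof.
move=> [e0 e1 He]; split=> // j x0 x1.
(* Here [b] selects the facet from which the segment comes. *)
suff H (b : bool) : `|val x 0 j - b%:R| <= 1 - e.
  have := H true; have := H false; rewrite !ler_norml /=.
  by move=> /andP[? ?] /andP[? ?]; apply/andP; split; lra.
have xjb : val x 0 j <> b%:R by case: b.
have [z Ez] : exists z : cube R n,
    val z = \row_k (if k == j then b%:R else val x 0 k).
  apply: cube_lift => k; rewrite mxE; case: eqP => _; last exact: coord_itv.
  by case: b {xjb}; rewrite ?lexx ?ler01.
have zk k : val z 0 k = if k == j then b%:R else val x 0 k by rewrite Ez mxE.
have xz : smallest_face x z.
  apply/smallest_faceP => k c xk; rewrite zk.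
  by case: eqP => // E; case: c xk; rewrite E.
have zx : z <> x by move=> E; apply: xjb; rewrite -E zk eqxx.
have [w [_ xw zw]] := He z xz zx.
have a0 := cdist_gt0 zx.
have zxE : cdist z x = `|val x 0 j - b%:R|.
  rewrite /cdist /edist (bigD1 j) //= big1 ?addr0 ?sqrtr_sqr ?zk ?eqxx 1?distrC //.
  by move=> k kj; rewrite zk (negPf kj) subrr expr0n.
have zw0 : 0 < edist (val z) (val w) by rewrite -/(cdist z w) zw; lra.
have btw : edist (val z) (val w) = edist (val z) (val x) + edist (val x) (val w).
  by rewrite -!/(cdist _ _) xw.
have := congr1 (fun v : 'rV_n => v 0 j) (edist_between zw0 btw).
rewrite -!/(cdist _ _) zw !mxE zk eqxx => E.
have E2 : (val x 0 j - b%:R) * (cdist z x + e) =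
          cdist z x * (val w 0 j - b%:R).
  by rewrite {1}E; field; rewrite gt_eqF //; lra.
have := coord_itv w j => /andP[w0 w1].
have E3 : `|val x 0 j - b%:R| * (cdist z x + e) =
          cdist z x * `|val w 0 j - b%:R|.
  rewrite -[cdist z x + e]gtr0_norm; last by lra.
  by rewrite -normrM E2 normrM (gtr0_norm a0).
rewrite -zxE in E3 *.
have {}E3 : cdist z x + e = `|val w 0 j - b%:R|.
  by apply: (mulfI _ E3); rewrite gt_eqF.
suff : `|val w 0 j - b%:R| <= 1 by lra.
by rewrite ler_norml; case: b {xjb zk xz zx zw zw0 Ez zxE E E2 E3 btw a0 xw} => /=; apply/andP; split; lra.
Qed.

(** A midpoint has a coordinate in [{0, 1}] only where both endpoints have that
    same coordinate, so its smallest face contains those of the endpoints. A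
    point of [S] whose smallest face has the largest dimension therefore has
    all of [S] in its smallest face. *)
Lemma midpoint_closed_face (S : set (cube R n)) :
  S !=set0 ->
  (forall x, S x -> smallest_face x `<=` S) ->
  (forall x y m, S x -> S y ->
     val m = (1 - 2^-1) *: val x + 2^-1 *: val y -> S m) ->
  exists f, S = face f.
Proof.
move=> [x0 Sx0] Ssat Smid.
pose F x := [set j | (val x 0 j != 0) && (val x 0 j != 1)]%SET.
pose P k := `[< exists2 x, S x & #|F x| = k >].
have exP : exists k, P k by exists #|F x0|; apply/asboolP; exists x0.
have ubP k : P k -> (k <= n)%N.
  by move=> /asboolP[x _ <-]; rewrite -[leqRHS]card_ord max_card.
have [k /asboolP[x Sx Fx] kmax] := ex_maxnP exP ubP.
exists (face_code x); rewrite face_codeE; apply/seteqP; split=> [y Sy|]; last exact: Ssat.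
have [|m Em] := @cube_conv x y 2^-1; first by apply/andP; split; lra.
have Sm := Smid _ _ _ Sx Sy Em.
have mE j : val m 0 j = (val x 0 j + val y 0 j) / 2.
  by rewrite Em !mxE; field.
have xm : F x \subset F m.
  apply/fintype.subsetP => j; rewrite !inE => /andP[/eqP a /eqP b].
  have /andP[? ?] := coord_itv x j; have /andP[? ?] := coord_itv y j.
  apply/andP; split; apply/eqP; rewrite mE => E.
    by apply: a; lra.
  by apply: b; lra.
have Fmx : F x = F m.
  apply/eqP; rewrite eqEcard xm Fx; apply: kmax; apply/asboolP.
  by exists m.
apply/smallest_faceP => j b xj.
have : j \notin F m by rewrite -Fmx inE xj; case: (b); rewrite eqxx ?andbF.
have /andP[? ?] := coord_itv x j; have /andP[? ?] := coord_itv y j.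
rewrite inE negb_and !negbK mE xj => /orP[] /eqP.
  by case: b xj => /= ? ?; lra.
by case: b xj => /= ? ?; lra.
Qed.

End CubeGeometry.

(** * Lifts of a point to different cubes *)

Section Lifts.
Variables (R : realType) (C : cube_complex R).

Lemma lift_unique (i : cell C) (x y : cube R (cell_dim i)) :
  smallest_face x y -> smallest_face y x -> cell_map x = cell_map y -> x = y.
Proof.
move=> xy yx; apply: (cell_map_inj (f := face_code x)).
  by apply: face_code_interior; exact: smallest_face_refl.
exact: face_code_interior.
Qed.

(** The isometry of smallest faces that comes with two lifts [x1] and [x2] of a
    point is not required to map [x1] to [x2], but it does. Otherwise the
    segment from [x2] to [h x1] can be extended beyond [h x1], because its
    preimage can be extended beyond [x1]. As [x2] is interior to its smallest
    face, so is then [h x1], and two lifts of one point in the interior of a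
    face coincide. *)
Lemma lift_isometry (i1 i2 : cell C)
    (x1 : cube R (cell_dim i1)) (x2 : cube R (cell_dim i2)) :
  cell_map x1 = cell_map x2 ->
  exists h : cube R (cell_dim i1) -> cube R (cell_dim i2),
    [/\ forall y z, smallest_face x1 y -> smallest_face x1 z ->
          cdist (h y) (h z) = cdist y z,
        h @` smallest_face x1 = smallest_face x2,
        forall y, smallest_face x1 y -> cell_map (h y) = cell_map y
      & h x1 = x2].
Proof.
move=> x12; have [h [iso img pres]] := cell_map_isometry x12.
have {}iso y z : smallest_face x1 y -> smallest_face x1 z ->
    cdist (h y) (h z) = cdist y z by move=> ? ?; apply: iso; rewrite inE.
have {}pres y : smallest_face x1 y -> cell_map (h y) = cell_map y.
  by move=> ?; rewrite pres // inE.
have x1x1 := smallest_face_refl (x := x1).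
exists h; split=> //; apply: contrapT => hx.
have hx1F : smallest_face x2 (h x1) by rewrite -img; exists x1.
have [z' z'F hz'] : (h @` smallest_face x1) x2.
  by rewrite img; exact: smallest_face_refl.
have z'x1 : z' <> x1 by move=> E; apply: hx; rewrite -E.
have [e /clearance_extendable [e0 _ /(_ z' z'F z'x1)[w' [w'F xw zw]]]] :=
  clearance_exists x1.
have xw2 : cdist (h x1) (h w') = e by rewrite iso.
have zw2 : cdist x2 (h w') = cdist x2 (h x1) + e by rewrite -{1 2}hz' !iso.
have a0 : 0 < cdist x2 (h x1) by apply: cdist_gt0 => E; apply: hx.
have D0 : 0 < cdist x2 (h w') by lra.
have D0n : cdist x2 (h w') != 0 by rewrite gt_eqF.
apply: hx; apply: lift_unique => //; last by rewrite pres.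
have btw : edist (val x2) (val (h w')) =
    edist (val x2) (val (h x1)) + edist (val (h x1)) (val (h w')).
  by rewrite -!/(cdist _ _) xw2.
apply/smallest_faceP => j b yj.
have := congr1 (fun v : 'rV_(_) => v 0 j) (edist_between D0 btw).
rewrite -!/(cdist _ _) !mxE yj.
set t := (_ / _) => E.
have t0 : 0 <= t by rewrite divr_ge0 // ltW.
have t1 : t < 1 by rewrite /t ltr_pdivrMr // mul1r; lra.
have /andP[? ?] := coord_itv x2 j; have /andP[? ?] := coord_itv (h w') j.
by case: b {yj} E => /= E; nra.
Qed.

Lemma lift_clearance (i1 i2 : cell C) e
    (x1 : cube R (cell_dim i1)) (x2 : cube R (cell_dim i2)) :
  cell_map x1 = cell_map x2 -> clearance e x1 -> clearance e x2.
Proof.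
move=> x12 /clearance_extendable [e0 e1 He]; apply: extendable_clearance.
have [h [iso img pres hx]] := lift_isometry x12.
have x1x1 := smallest_face_refl (x := x1).
split=> // z; rewrite -img => -[z' z'F <-] zx.
have [|w [wF xw zw]] := He z' z'F; first by move=> E; apply: zx; rewrite E.
exists (h w); split; first by exists w.
  by rewrite -hx iso.
by rewrite -hx !iso.
Qed.

End Lifts.

(** * Cubes embed isometrically near a point *)

Section LocalIsometry.
Variables (R : realType) (C : cube_complex R).
Hypothesis hconn : pl_connected C.
Implicit Types (X A B : carrier C).

Lemma pl_length_ge0 (s : seq (segment C)) : 0 <= pl_length s.
Proof. by apply: sumr_ge0 => e _; exact: edist_ge0. Qed.

Lemma path_dist_le A B s : pl_path A s B -> path_dist A B <= pl_length s.
Proof.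
move=> p; apply: ge_inf; last by exists s.
by exists 0 => l [s' _ ->]; exact: pl_length_ge0.
Qed.

Lemma path_dist_cell (i : cell C) (x y : cube R (cell_dim i)) :
  path_dist (cell_map x) (cell_map y) <= cdist x y.
Proof.
have := @path_dist_le (cell_map x) (cell_map y) [:: Segment x y].
by rewrite /pl_length big_seq1; apply.
Qed.

(** The segment from [x] to [a] is dragged along the path: while it is shorter
    than the clearance of [X], its end over [X] lies in the smallest face of
    the moving point, and a gluing isometry carries it to the next cube. *)
Lemma path_lift e X s : (forall (i : cell C) (x : cube R (cell_dim i)),
    cell_map x = X -> clearance e x) ->
  forall A B, pl_path A s B ->
  forall (i : cell C) (x a : cube R (cell_dim i)),
    cell_map x = X -> cell_map a = A -> cdist x a + pl_length s < e ->
  exists (j : cell C) (x' b : cube R (cell_dim j)),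
    [/\ cell_map x' = X, cell_map b = B
      & cdist x' b <= cdist x a + pl_length s].
Proof.
move=> clr; elim: s => [|[k u v] s IH] A B /=.
  by move=> <- i x a xX aA _; exists i, x, a; rewrite /pl_length big_nil addr0.
move=> [uA vB] i x a xX aA; rewrite {1 2}/pl_length big_cons /= -/(pl_length s).
move=> lt_e.
have uv0 : 0 <= cdist u v := edist_ge0 _ _.
have s0 := pl_length_ge0 s.
have xa : smallest_face a x.
  by apply: clearance_smallest_face (clr _ _ xX) _; lra.
have [h [iso _ pres ha]] := lift_isometry (etrans aA (esym uA)).
have hxu : cdist (h x) u = cdist x a.
  by rewrite -ha iso //; exact: smallest_face_refl.
have tri : cdist (h x) v <= cdist x a + cdist u v.
  by rewrite -hxu; exact: edist_triangle.
have [||j [x' [b [x'X bB le]]]] := IH _ _ vB k (h x) v _ erefl.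
- by rewrite pres.
- by lra.
by exists j, x', b; split=> //; lra.
Qed.

(** The gluing isometry at [z1] carries [x1] to a lift of [cell_map x2] within
    [e] of [x2] itself. Two lifts in one cube that are closer to each other
    than the clearance lie in each other's smallest faces, hence coincide. *)
Lemma lift_dist_unique e (i j : cell C) (x1 z1 : cube R (cell_dim i))
    (x2 z2 : cube R (cell_dim j)) :
  clearance e x1 -> cell_map x1 = cell_map x2 -> cell_map z1 = cell_map z2 ->
  cdist x1 z1 < e / 2 -> cdist x2 z2 < e / 2 -> cdist x1 z1 = cdist x2 z2.
Proof.
move=> clr1 x12 z12 d1 d2; have [e0 _ _] := clr1.
have z1x1 : smallest_face z1 x1.
  by apply: clearance_smallest_face clr1 _; lra.
have [h [iso _ pres hz]] := lift_isometry z12.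
have x3 : cell_map (h x1) = cell_map x2 by rewrite pres.
have d3 : cdist (h x1) z2 = cdist x1 z1.
  by rewrite -hz iso //; exact: smallest_face_refl.
have near : cdist (h x1) x2 < e.
  have := edist_triangle (val (h x1)) (val z2) (val x2).
  by rewrite (edistC (val z2)) -!/(cdist _ _) d3; lra.
suff E : h x1 = x2 by rewrite -d3 E.
apply: (lift_unique _ _ x3).
  apply: clearance_smallest_face (lift_clearance x12 clr1) _.
  by rewrite /cdist edistC.
apply: clearance_smallest_face near.
exact: lift_clearance (etrans x12 (esym x3)) clr1.
Qed.

(** A path shorter than [cdist x y] would lift to a segment shorter than
    [cdist x y] with the same endpoints in [C], against [lift_dist_unique]. *)
Lemma local_isometry e (i : cell C) (x y : cube R (cell_dim i)) :
  clearance e x -> cdist x y < e / 2 ->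
  path_dist (cell_map x) (cell_map y) = cdist x y.
Proof.
move=> clr xy; have [e0 _ _] := clr.
apply/eqP; rewrite eq_le path_dist_cell /=; apply: lb_le_inf.
  by have [s sP] := hconn (cell_map x) (cell_map y); exists (pl_length s), s.
move=> l [s sP ->]; rewrite leNgt; apply/negP => short.
have [||j [x' [b [x'x by_ le]]]] := path_lift _ sP (i := i) (x := x) (a := x)
  erefl erefl (e := e).
- by move=> k z zx; apply: lift_clearance clr; rewrite zx.
- by rewrite /cdist edistxx; lra.
move: le; rewrite {2}/cdist edistxx add0r => le.
have := lift_dist_unique clr (esym x'x) (esym by_) xy.
by move=> /(_ ltac:(lra)); lra.
Qed.

End LocalIsometry.

(** * Geodesics in CAT(0) spaces *)

Section CAT0Geometry.
Variables (R : realType) (X : Type) (d : X -> X -> R).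
Hypothesis hcat : CAT0 d.

Lemma CAT0_dist_ge0 x y : 0 <= d x y.
Proof.
have [[d0 dC tri] _ _] := hcat.
have := tri x y x; rewrite (dC y x) (_ : d x x = 0); last exact/d0.
by lra.
Qed.

Lemma comparison_triangle (a b c : R) :
  0 <= a -> 0 <= b -> 0 <= c -> a <= b + c -> b <= c + a -> c <= a + b ->
  exists x y z : 'rV[R]_2, [/\ edist x y = a, edist y z = b & edist z x = c].
Proof.
move=> a0 b0 c0 abc bca cab.
have dist2 (p q p' q' : R) (r : R) : 0 <= r ->
    (p - p') ^+ 2 + (q - q') ^+ 2 = r ^+ 2 ->
    edist (\row_(k < 2) if k == 0 then p else q)
          (\row_(k < 2) if k == 0 then p' else q') = r.
  move=> r0 E; rewrite /edist !big_ord_recl big_ord0 !mxE /= addr0 E.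
  by rewrite sqrtr_sqr ger0_norm.
have [az|an] := eqVneq a 0.
  exists (\row_(k < 2) if k == 0 then 0 else 0), (\row_(k < 2) if k == 0 then 0 else 0),
    (\row_(k < 2) if k == 0 then b else 0).
  have bc : b = c by lra.
  by rewrite -bc az; split; apply: dist2 => //; ring.
(* [p] and [q] are the coordinates of [z] when [x] is the origin and [y] lies
   on the first axis; [p] comes from the law of cosines. *)
have ap : 0 < a by rewrite lt_neqAle eq_sym an.
pose p := (a ^+ 2 + c ^+ 2 - b ^+ 2) / (2 * a).
have pE : 2 * a * p = a ^+ 2 + c ^+ 2 - b ^+ 2.
  by rewrite /p mulrC divfK // mulf_neq0 // pnatr_eq0.
have q0 : 0 <= c ^+ 2 - p ^+ 2.
  have a2 : 0 < 2 * a by rewrite mulr_gt0.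
  have pc : p <= c.
    have : 0 <= (b - (a - c)) * (b + (a - c)) by apply: mulr_ge0; lra.
    by move=> ?; rewrite -(ler_pM2l a2); lra.
  have cp : - c <= p.
    have : 0 <= (a + c - b) * (a + c + b) by apply: mulr_ge0; lra.
    by move=> ?; rewrite -(ler_pM2l a2); lra.
  by rewrite subr_sqr mulr_ge0 //; lra.
pose q := Num.sqrt (c ^+ 2 - p ^+ 2).
have qE : q ^+ 2 = c ^+ 2 - p ^+ 2 by rewrite sqr_sqrtr.
exists (\row_(k < 2) if k == 0 then 0 else 0), (\row_(k < 2) if k == 0 then a else 0),
  (\row_(k < 2) if k == 0 then p else q).
split; apply: dist2 => //; first by ring.
- have -> : (a - p) ^+ 2 + (0 - q) ^+ 2 = a ^+ 2 - 2 * a * p + p ^+ 2 + q ^+ 2 by ring.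
  by rewrite qE pE; ring.
- by rewrite !subr0 qE; ring.
Qed.

(** Stewart's identity in the comparison triangle, applied to thinness for the
    point of the geodesic at parameter [t * d x y] and the vertex [z]. *)
Lemma geodesic_CN x y g z t : geodesic d x y g -> 0 <= t <= 1 ->
  d z (g (t * d x y)) ^+ 2 <=
  (1 - t) * d z x ^+ 2 + t * d z y ^+ 2 - t * (1 - t) * d x y ^+ 2.
Proof.
move=> gxy /andP[t0 t1]; have [[d0 dC tri] geo thin] := hcat.
have [g0 gD giso] := gxy.
have D0 := CAT0_dist_ge0 x y; set D := d x y in D0 g0 gD giso *.
have tD0 : 0 <= t * D by rewrite mulr_ge0.
have tD : t * D <= D by rewrite ler_piMl.
have [gyz Gyz] := geo y z; have [gzx Gzx] := geo z x.
have [||||||x' [y' [z' [xy' yz' zx']]]] := @comparison_triangle D (d y z) (d z x).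
- exact: D0.
- exact: CAT0_dist_ge0.
- exact: CAT0_dist_ge0.
- by have := tri x z y; rewrite (dC x z) (dC z y) addrC.
- by have := tri y x z; rewrite (dC y x) (dC x z) addrC.
- by have := tri z y x; rewrite (dC z y) (dC y x) addrC.
pose u' := (1 - t) *: x' + t *: y'.
have xu : edist x' u' = t * D.
  by rewrite (edist_scale (c := t) (z := x') (w := y')) ?xy' ?ger0_norm // => j; rewrite !mxE; ring.
have dxu : d x (g (t * D)) = t * D.
  by rewrite -{1}g0 giso ?lexx ?tD0 ?D0 ?tD // sub0r normrN ger0_norm.
have le : d (g (t * D)) z <= edist u' z'.
  apply: (thin x y z _ _ _ _ _ _ x' y' z' xy' yz' zx').
  - by exists g.
  - by exists gyz.
  - by exists gzx.
  - apply: Or31; split; last by rewrite dxu.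
      by exists (t * D) => //=; rewrite tD0.
    by exists t => //; rewrite t0.
  - apply: Or32; split => //.
      have [_ gyzD _] := Gyz; exists (d y z) => //=.
      by rewrite lexx CAT0_dist_ge0.
    by exists 1; rewrite ?lexx ?ler01 // subrr scale0r scale1r add0r.
have : d z (g (t * D)) ^+ 2 <= edist z' u' ^+ 2.
  by rewrite ler_sqr ?nnegrE ?edist_ge0 ?CAT0_dist_ge0 // dC edistC.
by rewrite edist_stewart (edistC z' y') xy' yz' zx' (dC z y).
Qed.

(** Unlike in [geodesic_CN], the dividing point [u] is only known by its
    distances to [x] and [y]. The inequality for [z := u] shows that it agrees
    with the point of a geodesic. *)
Lemma CAT0_CN x y u z t : 0 <= t <= 1 ->
  d x u = t * d x y -> d u y = (1 - t) * d x y ->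
  d z u ^+ 2 <=
  (1 - t) * d z x ^+ 2 + t * d z y ^+ 2 - t * (1 - t) * d x y ^+ 2.
Proof.
move=> t01 xu uy; have [[d0 dC tri] geo thin] := hcat.
have [g gxy] := geo x y; suff -> : u = g (t * d x y) by exact: geodesic_CN.
apply/d0/eqP; rewrite -sqrf_eq0 eq_le sqr_ge0 andbT.
apply: le_trans (geodesic_CN u gxy t01) _.
by rewrite (dC u x) xu uy le_eqVlt; apply/orP; left; apply/eqP; ring.
Qed.

Lemma CAT0_midpoint_unique x y u v :
  d x u = 2^-1 * d x y -> d u y = 2^-1 * d x y ->
  d x v = 2^-1 * d x y -> d v y = 2^-1 * d x y -> u = v.
Proof.
move=> xu uy xv vy; have [[d0 dC tri] geo thin] := hcat.
apply/d0/eqP; rewrite -sqrf_eq0 eq_le sqr_ge0 andbT.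
have t01 : 0 <= (2^-1 : R) <= 1 by apply/andP; split; lra.
have vy' : d v y = (1 - 2^-1) * d x y by rewrite vy; field.
apply: le_trans (@CAT0_CN x y v u _ t01 xv vy') _.
by rewrite (dC u x) xu uy; lra.
Qed.

(** Two geodesics, from [x] to [y] and from [u] to [z], that overlap from [u] to
    [y] form a geodesic. This is [CAT0_CN] for the side from [x] to [y], its
    point [u] and the opposite vertex [z]: as [u] is as far as [2 * h] from
    [z], the triangle is degenerate. *)
Lemma CAT0_geodesic_extend x u y z (k h : R) :
  0 <= k -> 0 < h -> d x u = k * h -> d x y = (k + 1) * h ->
  d u y = h -> d y z = h -> d u z = 2 * h -> d x z = (k + 2) * h.
Proof.
move=> k0 h0 xu xy uy yz uz; have [[d0 dC tri] geo thin] := hcat.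
have k1 : k + 1 != 0 by rewrite gt_eqF //; lra.
pose t := k / (k + 1).
have t01 : 0 <= t <= 1.
  by rewrite /t divr_ge0 ?ler_pdivrMr ?mul1r //=; lra.
have xu' : d x u = t * d x y by rewrite xu xy /t; field.
have uy' : d u y = (1 - t) * d x y by rewrite uy xy /t; field.
have := @CAT0_CN x y u z _ t01 xu' uy'.
rewrite (dC z u) (dC z x) (dC z y) uz yz xy => CN.
have CN' : (k + 1) * (2 * h) ^+ 2 <=
    d x z ^+ 2 + k * h ^+ 2 - k * ((k + 1) * h ^+ 2).
  have : (k + 1) * (2 * h) ^+ 2 <= (k + 1) * ((1 - t) * d x z ^+ 2 + t * h ^+ 2
     - t * (1 - t) * ((k + 1) * h) ^+ 2) by rewrite ler_pM2l //; lra.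
  by congr (_ <= _); rewrite /t; field.
apply/eqP; rewrite eq_le; apply/andP; split.
  by have := tri x y z; rewrite xy yz; lra.
rewrite -ler_sqr ?nnegrE ?CAT0_dist_ge0 //; first by lra.
by rewrite mulr_ge0 //; lra.
Qed.

End CAT0Geometry.

(** * Closed cubes are isometrically embedded and meet in faces *)

Section GlobalIsometry.
Variables (R : realType) (C : cube_complex R).
Hypothesis hconn : pl_connected C.
Hypothesis hcat : CAT0 (@path_dist R C).

(** The segment from [x] to [y] is cut into steps [h] so short that two
    consecutive steps are within reach of [local_isometry]; the distance from
    [x] then grows by [h] at each step, by [CAT0_geodesic_extend]. *)
Lemma open_cube_isometry (e : R) (i : cell C) (x y : cube R (cell_dim i)) :
  0 < e -> e <= 1 ->
  (forall j, e <= val x 0 j <= 1 - e) -> (forall j, e <= val y 0 j <= 1 - e) ->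
  path_dist (cell_map x) (cell_map y) = cdist x y.
Proof.
move=> e0 e1 xe ye; have [[d0 dC tri] _ _] := hcat.
have [->|/eqP xy] := eqVneq x y; first by rewrite /cdist edistxx; apply/d0.
have D0 := cdist_gt0 xy; set D := cdist x y in D0 *.
have [N Nlt] : exists N : nat, 4 * D / e < N.+1%:R.
  exists (Num.truncn (4 * D / e)); apply: truncnS_gt.
have N0 : 0 < N.+1%:R :> R by rewrite ltr0n.
have Nn : N.+1%:R != 0 :> R by rewrite gt_eqF.
pose h := D / N.+1%:R.
have h0 : 0 < h by rewrite divr_gt0.
have hN : N.+1%:R * h = D by rewrite mulrC divfK.
have he : 2 * h < e / 2.
  have : 4 * D < N.+1%:R * e by rewrite -ltr_pdivrMr.
  by rewrite -hN mulrCA ltr_pM2l //; lra.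
pose pt (k : nat) := (1 - k%:R / N.+1%:R) *: val x + (k%:R / N.+1%:R) *: val y.
have frac k : (k <= N.+1)%N -> 0 <= (k%:R / N.+1%:R : R) <= 1.
  by move=> kN; rewrite divr_ge0 //= ler_pdivrMr // mul1r ler_nat.
have pt_exists k : (k <= N.+1)%N -> exists z : cube R (cell_dim i), val z = pt k.
  by move=> /frac; exact: cube_conv.
have pt_dist k l (z w : cube R (cell_dim i)) : val z = pt k -> val w = pt l ->
    cdist z w = `|k%:R - l%:R| * h.
  move=> zk wl; rewrite /cdist zk wl edist_conv -mulrBl normrM mulrAC.
  by rewrite (gtr0_norm (x := _^-1)) ?invr_gt0 // -mulrA.
have pt_local k l (z w : cube R (cell_dim i)) : (k <= N.+1)%N ->
    val z = pt k -> val w = pt l -> `|k%:R - l%:R| <= 2 :> R ->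
    path_dist (cell_map z) (cell_map w) = `|k%:R - l%:R| * h.
  move=> /frac kN zk wl kl; rewrite -(pt_dist _ _ _ _ zk wl).
  apply: (local_isometry hconn (e := e)); last first.
    rewrite (pt_dist _ _ _ _ zk wl); apply: le_lt_trans he.
    by rewrite ler_pM2r.
  split=> // j _ _; rewrite zk !mxE.
  exact: conv_itv.
have x0 : val x = pt 0 by rewrite /pt mul0r subr0 scale1r scale0r addr0.
have main k : (k.+1 <= N.+1)%N -> forall z w : cube R (cell_dim i),
    val z = pt k -> val w = pt k.+1 ->
    path_dist (cell_map x) (cell_map z) = k%:R * h /\
    path_dist (cell_map x) (cell_map w) = k.+1%:R * h.
  elim: k => [|k IH] kN z w zk wk.
    by split; [rewrite (pt_local _ _ _ _ _ x0 zk) // | rewrite (pt_local _ _ _ _ _ x0 wk) //];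
      rewrite sub0r normrN ger0_norm // ler_nat.
  have [u uk] := pt_exists k (ltnW (ltnW kN)).
  have [xu xz] := IH (ltnW kN) u z uk zk; split=> //.
  have E1 : k.+1%:R = k%:R + 1 :> R by rewrite -natr1.
  have E2 : k.+2%:R = k%:R + 2 :> R by rewrite -addn2 natrD.
  rewrite E2; apply: (CAT0_geodesic_extend hcat (u := cell_map u) (y := cell_map z)) => //.
  - by rewrite -E1.
  - rewrite (pt_local _ _ _ _ _ uk zk) ?(ltnW (ltnW kN)) // E1.
      by rewrite opprD addrA subrr sub0r normrN normr1 mul1r.
    by rewrite opprD addrA subrr sub0r normrN normr1; lra.
  - rewrite (pt_local _ _ _ _ _ zk wk) ?(ltnW kN) // E1 E2.
      have -> : k%:R + 1 - (k%:R + 2) = - 1 :> R by ring.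
      by rewrite normrN normr1 mul1r.
    have -> : k%:R + 1 - (k%:R + 2) = - 1 :> R by ring.
    by rewrite normrN normr1; lra.
  - rewrite (pt_local _ _ _ _ _ uk wk) ?(ltnW (ltnW kN)) // E2.
      have -> : k%:R - (k%:R + 2) = - 2 :> R by ring.
      by rewrite normrN ger0_norm.
    have -> : k%:R - (k%:R + 2) = - 2 :> R by ring.
    by rewrite normrN ger0_norm.
have [z zN] := pt_exists N (leqnSn N).
have yN : val y = pt N.+1 by rewrite /pt divff // subrr scale0r scale1r add0r.
by have [_ ->] := main N (leqnn _) z y zN yN.
Qed.

(** Shrinking the cube towards its centre moves two points into the open cube,
    changes their Euclidean distance little, and moves them little. *)
Lemma cube_isometry (i : cell C) (x y : cube R (cell_dim i)) :
  path_dist (cell_map x) (cell_map y) = cdist x y.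
Proof.
apply/eqP; rewrite eq_le path_dist_cell /=.
have [[d0 dC tri] _ _] := hcat.
have [c Ec] : exists c : cube R (cell_dim i), val c = const_mx 2^-1.
  by apply: cube_lift => j; rewrite mxE; apply/andP; split; lra.
set K := cdist x y + cdist x c + cdist y c.
have K0 : 0 <= K by rewrite !addr_ge0 // edist_ge0.
(* [s] is the ratio by which the cube is shrunk towards its centre [c]. *)
suff H s : 0 < s -> s <= 1 ->
    cdist x y <= path_dist (cell_map x) (cell_map y) + s * K.
  rewrite leNgt; apply/negP => lt.
  set del := cdist x y - path_dist (cell_map x) (cell_map y).
  have del0 : 0 < del by rewrite subr_gt0.
  have delK : del <= K.
    rewrite /del /K; have := CAT0_dist_ge0 hcat (cell_map x) (cell_map y).
    have := edist_ge0 (val x) (val c); have := edist_ge0 (val y) (val c).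
    by rewrite -!/(cdist _ _); lra.
  have K1 : 0 < K by lra.
  have := H (del / (2 * K)).
  have -> : del / (2 * K) * K = del / 2 by field; rewrite gt_eqF.
  rewrite divr_gt0 ?mulr_gt0 // ler_pdivrMr ?mulr_gt0 // mul1r.
  move=> /(_ isT) le; have : del <= 2 * K by lra.
  by move=> /le; rewrite /del; lra.
move=> s0 s1.
have s01 : 0 <= s <= 1 by rewrite ltW.
have [x' Ex] := cube_conv x c s01; have [y' Ey] := cube_conv y c s01.
have inner (z z' : cube R (cell_dim i)) j :
    val z' = (1 - s) *: val z + s *: val c -> s / 2 <= val z' 0 j <= 1 - s / 2.
  move=> ->; rewrite Ec !mxE; have /andP[? ?] := coord_itv z j.
  by apply/andP; split; nra.
have xy' : path_dist (cell_map x') (cell_map y') = (1 - s) * cdist x y.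
  rewrite (open_cube_isometry (e := s / 2)) //; [|lra|lra| |].
  - rewrite /cdist (edist_scale (c := 1 - s) (z := val x) (w := val y)).
      by rewrite ger0_norm // subr_ge0.
    by move=> j; rewrite Ex Ey !mxE; ring.
  - by move=> j; apply: inner Ex.
  - by move=> j; apply: inner Ey.
have move_by (z z' : cube R (cell_dim i)) :
    val z' = (1 - s) *: val z + s *: val c -> cdist z z' = s * cdist z c.
  move=> E; rewrite /cdist (edist_scale (c := s) (z := val z) (w := val c)).
    by rewrite gtr0_norm.
  by move=> j; rewrite E !mxE; ring.
have t1 := tri (cell_map x') (cell_map x) (cell_map y').
have t2 := tri (cell_map x) (cell_map y) (cell_map y').
have p1 := path_dist_cell x x'; have p2 := path_dist_cell y y'.
rewrite (move_by _ _ Ex) in p1; rewrite (move_by _ _ Ey) in p2.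
rewrite xy' (dC (cell_map x')) in t1.
by rewrite /K; lra.
Qed.

Lemma cell_map_injective (i : cell C) : injective (@cell_map R C i).
Proof.
move=> x y xy; apply/val_inj/edist_eq0; rewrite -/(cdist x y) -cube_isometry.
by have [[d0 _ _] _ _] := hcat; apply/d0.
Qed.

Lemma closed_cube_midpoint (i j : cell C) (x y m : cube R (cell_dim i)) :
  closed_cube j (cell_map x) -> closed_cube j (cell_map y) ->
  val m = (1 - 2^-1) *: val x + 2^-1 *: val y ->
  closed_cube j (cell_map m).
Proof.
move=> [x2 _ xx2] [y2 _ yy2] mE.
have [|m2 m2E] := @cube_conv _ _ x2 y2 2^-1; first by apply/andP; split; lra.
have half (k : cell C) (a b c : cube R (cell_dim k)) :
    val c = (1 - 2^-1) *: val a + 2^-1 *: val b ->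
    path_dist (cell_map a) (cell_map c) =
      2^-1 * path_dist (cell_map a) (cell_map b) /\
    path_dist (cell_map c) (cell_map b) =
      2^-1 * path_dist (cell_map a) (cell_map b).
  move=> cE; rewrite !cube_isometry /cdist; split;
    rewrite (edist_scale (c := 2^-1) (z := val a) (w := val b));
    by [rewrite ger0_norm // invr_ge0 | move=> l; rewrite cE !mxE; field].
have [xm my] := half _ _ _ _ mE; have [xm2 my2] := half _ _ _ _ m2E.
rewrite xx2 yy2 in xm2 my2.
exists m2 => //; exact: (CAT0_midpoint_unique hcat xm2 my2 xm my).
Qed.

Lemma closed_cube_face (i j : cell C) :
  closed_cube i `&` closed_cube j !=set0 ->
  exists f : 'I_(cell_dim i) -> option bool,
    closed_cube i `&` closed_cube j = [set cell_map x | x in face f].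
Proof.
move=> [_ [[x0 _ <-] x0j]].
pose S := [set x : cube R (cell_dim i) | closed_cube j (cell_map x)].
have [||| f Sf] := @midpoint_closed_face R (cell_dim i) S.
- by exists x0.
- move=> x [x' _ xx'] y xy; have [h [_ _ pres _]] := lift_isometry (esym xx').
  by exists (h y) => //; exact: pres.
- by move=> x y m; exact: closed_cube_midpoint.
exists f; rewrite -Sf; apply/seteqP; split=> c.
  by move=> [[x _ <-] xj]; exists x.
by move=> [x xj <-]; split=> //; exists x.
Qed.

End GlobalIsometry.

Theorem theoremC4 (R : realType) (C : cube_complex R)
    (hconn : pl_connected C) (hcat : CAT0 (@path_dist R C)) :
  cubical C.
Proof.
split=> [|i j]; first exact: cell_map_injective.
have [-> | /set0P ij] := eqVneq (closed_cube i `&` closed_cube j) set0; first by left.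
have [f fE] := closed_cube_face hconn hcat ij.
rewrite setIC in ij; have [g gE] := closed_cube_face hconn hcat ij.
by right; exists f, g; split=> //; rewrite setIC.
Qed.
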